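(* Let $n,N_c\ge1$, let $\Lambda\in\mathbb R^{n\times n}$, $K_\varepsilon,\Gamma_\varepsilon\in\mathbb R^{N_c\times N_c}$ and $C_\varepsilon\in\mathbb R^{n\times N_c}$ be as described in the context, and consider the coupled system $$\ddot a+\Lambda a=C_\varepsilon\eta,\qquad \ddot\eta+2\Gamma_\varepsilon\dot\eta+K_\varepsilon\eta=C_\varepsilon^\top a,\qquad t\ge0.$$ Suppose that $$K_\varepsilon-C_\varepsilon^\top\Lambda^{-1}C_\varepsilon>0,$$ that $\Gamma_\varepsilon>0$, and that $$\operatorname{Ker}(\Lambda-\lambda^2I)\cap\operatorname{Ker}(C_\varepsilon^\top)=\{0\}\qquad\text{for every }\lambda^2\in\sigma(\Lambda).$$ Then there exist $M_\varepsilon\ge1$ and $\delta_\varepsilon>0$ such that every solution satisfies $$E_\varepsilon(t)\le M_\varepsilon e^{-\delta_\varepsilon t}E_\varepsilon(0),\qquad t\ge0.$$ Moreover, for fixed $\Lambda,K_\varepsilon,C_\varepsilon$ and $\Gamma_\varepsilon=\gamma_\varepsilon\Gamma_0$ with fixed $\Gamma_0>0$ and $0<\gamma_\varepsilon\ll1$, one has $\delta_\varepsilon=O(\gamma_\varepsilon)$.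
   Context: $\Lambda$ is diagonal with strictly positive diagonal entries $\omega_k^2$ (so $\Lambda>0$); $K_\varepsilon$ and $\Gamma_\varepsilon$ are real diagonal matrices with positive diagonal entries, in the model $\Gamma_\varepsilon=\operatorname{diag}(\gamma_\alpha^\varepsilon)$ and $K_\varepsilon=\operatorname{diag}((\omega_\alpha^\varepsilon)^2+(\gamma_\alpha^\varepsilon)^2)$; $C_\varepsilon$ is a real matrix; $\Gamma_0$ is a diagonal matrix with positive diagonal entries. For symmetric matrices, $>0$ means positive definite. $\sigma(\Lambda)$ is the spectrum. The unknowns are $a(t)\in\mathbb R^n$ and $\eta(t)\in\mathbb R^{N_c}$. With $X=(a^\top,\eta^\top)^\top$ and $$\mathbb G_\varepsilon=\begin{pmatrix}\Lambda&-C_\varepsilon\\-C_\varepsilon^\top&K_\varepsilon\end{pmatrix},$$ the energy of a solution is $E_\varepsilon(t)=\frac12\big(\dot X^\top\dot X+X^\top\mathbb G_\varepsilon X\big)$. In the last assertion the $O$ refers to $\gamma_\varepsilon\to0^+$, with constants depending only on the fixed matrices $\Lambda,K_\varepsilon,C_\varepsilon,\Gamma_0$. *)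

(* Defs.v *)
From HB Require Import structures.
From mathcomp Require Import all_boot all_order all_algebra.
From mathcomp Require Import all_classical all_reals all_analysis.

Set Implicit Arguments.
Unset Strict Implicit.
Unset Printing Implicit Defensive.

Import Order.TTheory GRing.Theory Num.Theory.
Import numFieldNormedType.Exports.

Local Open Scope classical_set_scope.
Local Open Scope ring_scope.

(* For K and Gam this is all that is assumed: the model
   Gam = diag(gamma_j), K = diag(omega_j^2 + gamma_j^2), gamma_j > 0,
   is the instance it contains. *)
Definition posdiag (R : realType) (n : nat) (A : 'M[R]_n) : Prop :=
  is_diag_mx A /\ forall i, 0 < A i i.

Definition posdef (R : realType) (n : nat) (A : 'M[R]_n) : Prop :=
  A^T = A /\ forall x : 'cV[R]_n, x != 0 -> 0 < (x^T *m A *m x) 0 0.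

(* g is the derivative of f on the closed half-line [0, +oo[: the difference
   quotients are restricted to s >= 0, so the derivative is two-sided at t > 0
   and one-sided at t = 0. The values of f and g at negative times are
   irrelevant. *)
Definition deriv_halfline (R : realType) (V : normedModType R)
    (f g : R -> V) : Prop :=
  forall t, 0 <= t ->
    (s - t)^-1 *: (f s - f t) @[s --> within [set s | 0 <= s] t^'] --> g t.

(* da and deta stand for the velocities of a and eta. *)
Definition is_solution (R : realType) (n Nc : nat)
    (L : 'M[R]_n) (K : 'M[R]_Nc) (C : 'M[R]_(n, Nc)) (Gam : 'M[R]_Nc)
    (a da : R -> 'cV[R]_n) (eta deta : R -> 'cV[R]_Nc) : Prop :=
  exists (dda : R -> 'cV[R]_n) (ddeta : R -> 'cV[R]_Nc),
    [/\ deriv_halfline a da /\ deriv_halfline da dda,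
        deriv_halfline eta deta /\ deriv_halfline deta ddeta,
        forall t, 0 <= t -> dda t + L *m a t = C *m eta t &
        forall t, 0 <= t ->
          ddeta t + 2 *: (Gam *m deta t) + K *m eta t = C^T *m a t].

Definition stiffness (R : realType) (n Nc : nat)
    (L : 'M[R]_n) (K : 'M[R]_Nc) (C : 'M[R]_(n, Nc)) : 'M[R]_(n + Nc) :=
  block_mx L (- C) (- C^T) K.

Definition energy (R : realType) (n Nc : nat)
    (L : 'M[R]_n) (K : 'M[R]_Nc) (C : 'M[R]_(n, Nc))
    (a da : R -> 'cV[R]_n) (eta deta : R -> 'cV[R]_Nc) (t : R) : R :=
  let X := col_mx (a t) (eta t) in
  let dX := col_mx (da t) (deta t) in
  2^-1 * (dX^T *m dX + X^T *m stiffness L K C *m X) 0 0.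

Definition energy_decay (R : realType) (n Nc : nat)
    (L : 'M[R]_n) (K : 'M[R]_Nc) (C : 'M[R]_(n, Nc)) (Gam : 'M[R]_Nc)
    (M delta : R) : Prop :=
  forall (a da : R -> 'cV[R]_n) (eta deta : R -> 'cV[R]_Nc),
    is_solution L K C Gam a da eta deta ->
    forall t, 0 <= t ->
      energy L K C a da eta deta t <=
        M * expR (- delta * t) * energy L K C a da eta deta 0.

(* Main.v *)
Require Import Defs.
From HB Require Import structures.
From mathcomp Require Import all_boot all_order all_algebra.
From mathcomp Require Import all_classical all_reals all_analysis.
From mathcomp Require Import ring lra.

(** Along a solution the energy satisfies [E' = - 2 eta'^T Gamma eta'], and it is
    comparable to the squared norm of the state because its potential part splits as
    [w^T Lambda w + eta^T (K - C^T Lambda^-1 C) eta] with [w = a - Lambda^-1 C eta].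

    Decay. A quadratic quantity [q] is controlled by the dissipation if, for every
    [e > 0], some quadratic functional [V] satisfies [V' <= - q + M |eta'|^2 + e E].
    If [|F|^2] is controlled for a linear observable [F], so is [|F'|^2]: use
    [V = - <F, F'>] and absorb [<F, F''>] by Young's inequality. Starting from
    [eta'], this yields [C^T Lambda^k a'] for all [k], hence [C^T P a'] for each spectral
    projection [P] of [Lambda]; by the kernel condition it yields [a'], then
    [C eta - Lambda a], then [eta] through the Schur complement, and finally [a]. So
    [E] itself is controlled, and [E + theta V] is a strict Lyapunov functional for
    small [theta].

    Rate. Since [E' >= - c gamma E], no nonzero solution decays faster than
    [exp (- c gamma t)]; a nonzero solution is given by a power series. *)

Import Order.TTheory GRing.Theory Num.Theory.
Import numFieldNormedType.Exports.

Local Open Scope classical_set_scope.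
Local Open Scope ring_scope.

(** * Derivatives on the half-line *)

Section HalfLineDerivative.
Set Implicit Arguments.
Unset Strict Implicit.
Variable R : realType.
Implicit Types f g : R -> R.

(* Weaker than [deriv_halfline]: only right-continuity is kept at time [0]. *)
Definition halfline_derive f g : Prop :=
  (forall t : R, 0 < t -> is_derive t 1 f (g t)) /\ f s @[s --> 0^'+] --> f 0.

Lemma is_derive_quotient f (t d : R) :
  h^-1 * (f (h + t) - f t) @[h --> 0^'] --> d -> is_derive t 1 f d.
Proof.
move=> fd.
have qE : (fun h => h^-1 *: ((f \o shift t) (h *: (1 : R)) - f t)) =
          (fun h => h^-1 * (f (h + t) - f t)).
  by apply/funext => h /=; rewrite [h%:A]mulr1.
by constructor; rewrite /derivable /derive qE; [apply/cvg_ex; exists d | exact: cvg_lim].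
Qed.

(** At [t > 0] a ball of radius at most [t] stays in the half-line, so the restriction is void
    there. At [0] the convergent difference quotient is eventually below [|g 0| + 1] in absolute
    value, which makes [f] right-continuous. *)
Lemma deriv_halfline_scalar f g :
  deriv_halfline f g -> halfline_derive f g.
Proof.
move=> fg; split=> [t t0|].
  apply: is_derive_quotient; apply/cvgrPdist_lt => e e0.
  have /cvgrPdist_lt/(_ _ e0) := fg t (ltW t0).
  rewrite !near_withinE => /nbhs_ballP[r /= r0 H].
  apply/nbhs_ballP; exists (Num.min r t); first by rewrite /= lt_min r0.
  move=> h /=; rewrite /ball /= sub0r normrN lt_min => /andP[hr ht] h0.
  have := H (h + t); rewrite addrK; apply => //=.
  - by rewrite /ball /= opprD addrCA subrr addr0 normrN.
  - by rewrite -subr_eq0 addrK.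
  - by move: ht; rewrite ltr_norml => /andP[ht _]; lra.
have /cvgrPdist_lt/(_ _ ltr01) := fg 0 (lexx 0).
rewrite near_withinE => /nbhs_ballP[r /= r0 H].
apply/cvgrPdist_lt => e e0; rewrite near_withinE.
have D0 : 0 < `|g 0| + 1 by rewrite ltr_wpDl.
apply/nbhs_ballP; exists (Num.min r (e / (`|g 0| + 1))).
  by rewrite /= lt_min r0 divr_gt0.
move=> s; rewrite /ball /= sub0r normrN lt_min => /andP[sr se] s0.
have := H s; rewrite /ball /= sub0r normrN subr0 => /(_ sr (lt0r_neq0 s0) (ltW s0)) q1.
have q2 : `|s^-1 * (f s - f 0)| < `|g 0| + 1.
  rewrite -[X in `|X|](subrK (g 0)) addrC (le_lt_trans (ler_normD _ _))//.
  by rewrite ltrD2l distrC.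
have -> : f 0 - f s = - (s * (s^-1 * (f s - f 0))).
  by rewrite mulrA divff ?mul1r ?opprB// gt_eqF.
rewrite normrN normrM (lt_le_trans (y := `|s| * (`|g 0| + 1)))//.
  by rewrite ltr_pM2l// normr_gt0 gt_eqF.
by rewrite -ler_pdivlMr// ltW.
Qed.

Lemma deriv_halfline_coord m (u v : R -> 'cV[R]_m) (i : 'I_m) :
  deriv_halfline u v -> halfline_derive (fun t => u t i 0) (fun t => v t i 0).
Proof.
move=> uv; apply: deriv_halfline_scalar => t t0.
have /(_ (v t)) C := @coord_continuous R m 1 i 0.
have := cvg_comp _ _ (uv t t0) C.
by apply: cvg_trans; apply: near_eq_cvg; near=> s; rewrite /= !mxE.
Unshelve. all: by end_near.
Qed.

Lemma halfline_deriveD f g df dg : halfline_derive f df -> halfline_derive g dg ->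
  halfline_derive (fun t => f t + g t) (fun t => df t + dg t).
Proof.
move=> [f1 f2] [g1 g2]; split=> [t t0|]; last exact: cvgD.
have ? := f1 _ t0; have ? := g1 _ t0.
exact: is_deriveD.
Qed.

Lemma halfline_deriveM f g df dg : halfline_derive f df -> halfline_derive g dg ->
  halfline_derive (fun t => f t * g t) (fun t => df t * g t + f t * dg t).
Proof.
move=> [f1 f2] [g1 g2]; split=> [t t0|]; last exact: cvgM.
have ? := f1 _ t0; have ? := g1 _ t0.
apply: is_derive_eq; rewrite addrC; congr (_ + _).
by rewrite /GRing.scale/= mulrC.
Qed.

Lemma halfline_derive_cst c : halfline_derive (fun=> c) (fun=> 0).
Proof. by split=> [t _|]; [exact: is_derive_cst | exact: cvg_cst]. Qed.

Lemma halfline_deriveZ c f df : halfline_derive f df ->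
  halfline_derive (fun t => c * f t) (fun t => c * df t).
Proof.
move=> /(halfline_deriveM (halfline_derive_cst c)).
by under [X in halfline_derive _ X]eq_fun do rewrite mul0r add0r.
Qed.

Lemma halfline_derive_sum m (f df : 'I_m -> R -> R) :
  (forall i, halfline_derive (f i) (df i)) ->
  halfline_derive (fun t => \sum_i f i t) (fun t => \sum_i df i t).
Proof.
elim: m f df => [|m IH] f df fdf.
  under eq_fun do rewrite big_ord0.
  by under [X in halfline_derive _ X]eq_fun do rewrite big_ord0; exact: halfline_derive_cst.
under eq_fun do rewrite big_ord_recl.
under [X in halfline_derive _ X]eq_fun do rewrite big_ord_recl.
by apply: halfline_deriveD => //; exact: IH.
Qed.

Lemma halfline_derive_ext f df dg : (forall t, 0 < t -> df t = dg t) ->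
  halfline_derive f df -> halfline_derive f dg.
Proof. by move=> E [f1 f2]; split=> // t t0; rewrite -E//; exact: f1. Qed.

Lemma halfline_derive_le0 f df : halfline_derive f df ->
  (forall t, 0 < t -> df t <= 0) -> forall t, 0 <= t -> f t <= f 0.
Proof.
move=> [f1 f2] f3 t t0.
have D (s : R) : s \in `]0, +oo[ -> is_derive s 1 f (df s).
  by rewrite in_itv/= andbT; exact: f1.
apply: (ler0_derive1_nincry (a := 0)) => // [s /D[]//|s s0|].
  by rewrite derive1E; have [_ ->] := D _ s0; move: s0; rewrite in_itv/= andbT; exact: f3.
apply/continuous_within_itvcyP; split=> // s /D[ds _].
by apply/differentiable_continuous; rewrite -derivable1_diffP.
Qed.

Lemma halfline_derive_expM k f df : halfline_derive f df ->
  halfline_derive (fun t => expR (k * t) * f t)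
    (fun t => expR (k * t) * (k * f t + df t)).
Proof.
move=> fdf; have E : halfline_derive (fun t => expR (k * t)) (fun t => k * expR (k * t)).
  split=> [t _|].
    have ? : is_derive t 1 (fun s : R => k * s) k.
      by apply: is_derive_eq; rewrite [LHS]mulr1.
    rewrite mulrC; exact: (is_derive1_comp (is_derive_expR _) _).
  apply: cvg_at_right_filter.
  have : continuous (fun t : R => expR (k * t)).
    by move=> t; apply: continuous_comp; [exact: mulrl_continuous | exact: continuous_expR].
  exact.
apply: halfline_derive_ext (halfline_deriveM E fdf) => t _; ring.
Qed.

(** The integrating factor [expR (k * t)] turns the differential inequality into monotonicity. *)
Lemma gronwall_le k f df : halfline_derive f df ->
  (forall t, 0 < t -> df t <= - k * f t) ->
  forall t, 0 <= t -> f t <= expR (- k * t) * f 0.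
Proof.
move=> fdf le t t0.
have := halfline_derive_le0 (halfline_derive_expM k fdf) _ t0.
rewrite mulr0 expR0 mul1r => /(_ _)/wrap[s s0|H].
  by rewrite mulr_ge0_le0 ?expR_ge0//; have := le _ s0; lra.
rewrite -(ler_pM2l (expR_gt0 (k * t))) mulrA -expRD.
by rewrite (_ : k * t + - k * t = 0) ?expR0 ?mul1r//; ring.
Qed.

Lemma gronwall_ge k f df : halfline_derive f df ->
  (forall t, 0 < t -> - k * f t <= df t) ->
  forall t, 0 <= t -> expR (- k * t) * f 0 <= f t.
Proof.
move=> fdf ge t t0.
have := gronwall_le (k := k) (halfline_deriveZ (-1) fdf) _ t0.
move=> /(_ _)/wrap[s s0|]; last lra.
by have := ge _ s0; lra.
Qed.

End HalfLineDerivative.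

(** * Power series solutions of linear systems *)

Section LinearODE.
Variable R : realType.
Set Implicit Arguments.
Unset Strict Implicit.

(** A neighbourhood of a matrix contains a product of neighbourhoods of its entries, so finitely
    many scalar limits suffice; each one survives the restriction to [s >= 0]. *)
Lemma is_derive_deriv_halfline m (u v : R -> 'cV[R]_m) :
  (forall (t : R) i, is_derive t 1 (fun s => u s i 0) (v t i 0)) -> deriv_halfline u v.
Proof.
move=> uv t t0 A [P MP sPA].
have q i : (s - t)^-1 * (u s i 0 - u t i 0) @[s --> within [set s | 0 <= s] t^'] --> v t i 0.
  apply/cvgrPdist_lt => e e0; have [] := uv t i.
  rewrite /derivable /derive => /[swap] vE /[!vE] /cvgrPdist_lt/(_ _ e0).
  rewrite !near_withinE => /nbhs_ballP[r /= r0 H].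
  apply/nbhs_ballP; exists r => //= s; rewrite /ball/= => st sNt s0.
  have := H (s - t); rewrite /ball/= sub0r normrN distrC => /(_ st).
  rewrite subr_eq0 => /(_ sNt).
  by rewrite [_%:A]mulr1 subrK.
have F : \forall s \near within [set s | 0 <= s] t^',
    forall i, P i 0 ((s - t)^-1 * (u s i 0 - u t i 0)).
  by apply: filter_forall => i; exact: q (MP i 0).
apply: filterS F => s Ps; apply: sPA => i j; rewrite (ord1 j) /= !mxE; exact: Ps.
Qed.

Section Flow.
Variables (N : nat) (A : 'M[R]_N).

(** These are the Taylor coefficients of coordinate [i] of [exp (t A) v]. Working by coordinates
    reduces the matrix exponential to scalar power series. *)
Definition flow_coef (v : 'cV[R]_N) i k : R := iter k (mulmx A) v i 0 / k`!%:R.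

Definition flow (v : 'cV[R]_N) (t : R) : 'cV[R]_N :=
  \col_i limn (pseries (flow_coef v i) t).

Lemma flow_coef_le (v : 'cV[R]_N) i k :
  `|iter k (mulmx A) v i 0| <= (\sum_i \sum_j `|A i j|) ^+ k * \sum_i `|v i 0|.
Proof.
set B := \sum_i _; set W := \sum_i _.
have B0 : 0 <= B by do 2 apply: sumr_ge0 => ? _.
(* A single coordinate does not give an inductive bound; the l1 norm does, since the sum [B] of the
   absolute entries bounds the l1 operator norm of [A]. *)
suff S : \sum_i `|iter k (mulmx A) v i 0| <= B ^+ k * W.
  by apply: le_trans S; rewrite (bigD1 i)//= lerDl sumr_ge0.
elim: k => [|k IH]; first by rewrite expr0 mul1r.
rewrite exprS -mulrA; apply: le_trans (ler_wpM2l B0 IH).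
rewrite /B mulr_suml; apply: ler_sum => j _; rewrite iterS mxE.
apply: le_trans (ler_norm_sum _ _ _) _.
rewrite mulr_suml; apply: ler_sum => l _; rewrite normrM ler_wpM2l//.
by rewrite (bigD1 l)//= lerDl sumr_ge0.
Qed.

(** The series is dominated termwise by that of [W * expR (B * |t|)]. *)
Lemma flow_cvg v i (t : R) : cvgn (pseries (flow_coef v i) t).
Proof.
apply: normed_cvg; set B := \sum_i \sum_j `|A i j|; set W := \sum_i `|v i 0|.
have B0 : 0 <= B by do 2 apply: sumr_ge0 => ? _.
apply: (@series_le_cvg _ _ (fun k => W * exp_coeff (B * `|t|) k)) => [k|k|k|] //.
- exact: normr_ge0.
- by rewrite mulr_ge0 ?sumr_ge0// exp_coeff_ge0 ?mulr_ge0//.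
- rewrite /flow_coef /exp_coeff /= !normrM normrX normfV [`|k`!%:R|]ger0_norm//.
  rewrite exprMn; have := flow_coef_le v i k; rewrite -/B -/W => H.
  rewrite (_ : W * _ = B ^+ k * W * k`!%:R^-1 * `|t| ^+ k); last by ring.
  by rewrite !ler_wpM2r ?exprn_ge0// invr_ge0.
- exact/is_cvg_seriesZ/is_cvg_series_exp_coeff.
Qed.

Lemma flow_coef_diffs v i :
  pseries_diffs (flow_coef v i) = flow_coef (A *m v) i.
Proof.
apply/funext => k; rewrite /pseries_diffs /flow_coef iterSr factS natrM invfM.
by rewrite mulrCA (mulrA k.+1%:R) divff ?mul1r// pnatr_eq0.
Qed.

(** [A] commutes with its own iterates, so the identity holds for partial sums. By [flow_coef_diffs]
    the left side is the termwise differentiated series, hence the differential equation. *)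
Lemma flow_lin v (t : R) : flow (A *m v) t = A *m flow v t.
Proof.
apply/colP => i; rewrite !mxE; under eq_bigr do rewrite mxE.
apply/cvg_lim => //.
rewrite (_ : pseries _ t = fun k => \sum_j A i j * pseries (flow_coef v j) t k); last first.
  apply/funext => k; rewrite /pseries /series /=.
  under [RHS]eq_bigr do rewrite mulr_sumr.
  rewrite exchange_big; apply: eq_bigr => l _.
  rewrite /flow_coef -iterSr iterS mxE !mulr_suml; apply: eq_bigr => j _; ring.
apply: cvg_big => [|j _]; first exact: add_continuous.
by apply: cvgM; [exact: cvg_cst | exact: flow_cvg].
Qed.

Lemma flow_derive v (t : R) i :
  is_derive t 1 (fun s => flow v s i 0) ((A *m flow v t) i 0).
Proof.
rewrite -flow_lin mxE -flow_coef_diffs.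
under eq_fun do rewrite mxE.
apply: (@pseries_snd_diffs _ _ (`|t| + 1)); rewrite ?flow_coef_diffs;
  try exact: flow_cvg.
by rewrite (@ger0_norm _ (`|t| + 1)) ?ltrDl// addr_ge0.
Qed.

Lemma flow0 v : flow v 0 = v.
Proof.
apply/colP => i; rewrite mxE; apply/cvg_lim => //.
rewrite -cvg_shiftS; apply: cvg_near_cst; near=> k.
rewrite /pseries /series/= big_nat_recl//= big1 ?addr0.
  by rewrite /flow_coef /= fact0 expr0 mulr1 divr1.
by move=> l _; rewrite exprS mul0r mulr0.
Unshelve. all: by end_near.
Qed.

End Flow.
End LinearODE.

(** * Quadratic forms *)

Section DotProduct.
Variable R : realType.
Set Implicit Arguments.
Unset Strict Implicit.

Definition dotv m (u v : 'cV[R]_m) : R := \sum_i u i 0 * v i 0.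

Lemma dotvE m (u v : 'cV[R]_m) : (u^T *m v) 0 0 = dotv u v.
Proof. by rewrite mxE; apply: eq_bigr => i _; rewrite mxE. Qed.

Lemma dotvC m (u v : 'cV[R]_m) : dotv u v = dotv v u.
Proof. by apply: eq_bigr => i _; rewrite mulrC. Qed.

Lemma dotvDr m (u v w : 'cV[R]_m) : dotv u (v + w) = dotv u v + dotv u w.
Proof. by rewrite -big_split; apply: eq_bigr => i _; rewrite mxE mulrDr. Qed.

Lemma dotvZr m c (u v : 'cV[R]_m) : dotv u (c *: v) = c * dotv u v.
Proof. by rewrite mulr_sumr; apply: eq_bigr => i _; rewrite mxE mulrCA. Qed.

Lemma dotvNr m (u v : 'cV[R]_m) : dotv u (- v) = - dotv u v.
Proof. by rewrite -scaleN1r dotvZr mulN1r. Qed.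

Lemma dotvDl m (u v w : 'cV[R]_m) : dotv (u + v) w = dotv u w + dotv v w.
Proof. by rewrite dotvC dotvDr !(dotvC w). Qed.

Lemma dotvZl m c (u v : 'cV[R]_m) : dotv (c *: u) v = c * dotv u v.
Proof. by rewrite dotvC dotvZr dotvC. Qed.

Lemma dotvNl m (u v : 'cV[R]_m) : dotv (- u) v = - dotv u v.
Proof. by rewrite dotvC dotvNr dotvC. Qed.

Lemma dotv0l m (u : 'cV[R]_m) : dotv 0 u = 0.
Proof. by rewrite /dotv big1// => i _; rewrite mxE mul0r. Qed.

Definition dotv_lin := (dotvDr, dotvDl, dotvNr, dotvNl, dotvZr, dotvZl).

Lemma dotv_ge0 m (u : 'cV[R]_m) : 0 <= dotv u u.
Proof. by apply: sumr_ge0 => i _; rewrite -expr2 sqr_ge0. Qed.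

Lemma dotv_gt0 m (u : 'cV[R]_m) : u != 0 -> 0 < dotv u u.
Proof.
move=> u0; rewrite lt_neqAle dotv_ge0 andbT eq_sym; apply: contra u0.
rewrite psumr_eq0 => [/allP H|i _]; last by rewrite -expr2 sqr_ge0.
apply/eqP/colP => i; rewrite mxE; apply/eqP.
by have := H i (mem_index_enum i); rewrite /= -expr2 sqrf_eq0.
Qed.

Lemma dotv_mulmxl m p (M : 'M[R]_(m, p)) u v : dotv (M *m u) v = dotv u (M^T *m v).
Proof. by rewrite -!dotvE trmx_mul mulmxA. Qed.

Lemma dotv_young m (u v : 'cV[R]_m) r : 0 < r ->
  2 * dotv u v <= r^-1 * dotv u u + r * dotv v v.
Proof.
move=> r0; have := dotv_ge0 (r^-1 *: u - v).
rewrite !dotv_lin (dotvC v u) => H.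
rewrite -subr_ge0; have := mulr_ge0 (ltW r0) H; congr (0 <= _).
by field; rewrite gt_eqF.
Qed.

Lemma dotv_youngN m (u v : 'cV[R]_m) r : 0 < r ->
  - (2 * dotv u v) <= r^-1 * dotv u u + r * dotv v v.
Proof. by move=> /(dotv_young (- u) v); rewrite !dotv_lin opprK mulrN. Qed.

Lemma posdef_gt0 m (S : 'M[R]_m) x : posdef S -> x != 0 -> 0 < dotv x (S *m x).
Proof. by move=> [_ /(_ x)/[apply]]; rewrite -mulmxA dotvE. Qed.

Lemma posdef_ge0 m (S : 'M[R]_m) x : posdef S -> 0 <= dotv x (S *m x).
Proof.
move=> S0; have [->|/(posdef_gt0 S0)/ltW//] := eqVneq x 0.
by rewrite mulmx0 dotv_ge0.
Qed.

Lemma posdef_unit m (S : 'M[R]_m) : posdef S -> S \in unitmx.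
Proof.
move=> S0; rewrite -row_free_unit -kermx_eq0; apply/rowV0P => v /sub_kermxP vS.
apply/eqP/negPn/negP => v0.
have vT0 : v^T != 0 by rewrite -(inj_eq trmx_inj) trmxK trmx0.
have := posdef_gt0 S0 vT0.
by rewrite -dotvE trmxK mulmxA vS mul0mx mxE ltxx.
Qed.

(** The form is nonnegative at [<y, S y> x - <x, S y> y], where it equals [<y, S y>] times the
    difference of the two sides. *)
Lemma posdef_CauchySchwarz m (S : 'M[R]_m) x y : posdef S ->
  dotv x (S *m y) ^+ 2 <= dotv x (S *m x) * dotv y (S *m y).
Proof.
move=> S0; have [->|y0] := eqVneq y 0.
  by rewrite mulmx0 -(scale0r x) dotvZr mul0r expr0n/= dotvZl mul0r mulr0.
have r0 := posdef_gt0 S0 y0.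
have := posdef_ge0 (dotv y (S *m y) *: x - dotv x (S *m y) *: y) S0.
rewrite !mulmxDr !mulmxN -!scalemxAr !dotv_lin.
have -> : dotv y (S *m x) = dotv x (S *m y) by rewrite dotvC dotv_mulmxl S0.1.
set p := dotv x _; set q := dotv x _; set r := dotv y _ in r0 *.
move=> H; rewrite -subr_ge0 -(pmulr_rge0 _ r0); move: H; congr (0 <= _); ring.
Qed.

(** With [z i] the preimage under [S] of the [i]-th basis vector, [x i 0 = <x, S (z i)>].
    Cauchy-Schwarz for the form of [S] bounds each squared coordinate, without compactness or
    eigenvalues. *)
Lemma posdef_coercive m (S : 'M[R]_m) : posdef S ->
  exists2 c, 0 <= c & forall x, dotv x x <= c * dotv x (S *m x).
Proof.
move=> S0; pose z i : 'cV[R]_m := invmx S *m delta_mx i 0.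
exists (\sum_i dotv (z i) (S *m z i)) => [|x].
  by apply: sumr_ge0 => i _; exact: posdef_ge0.
rewrite mulr_suml; apply: ler_sum => i _.
have xz : dotv x (S *m z i) = x i 0.
  rewrite mulKVmx ?posdef_unit// /dotv (bigD1 i)//= mxE !eqxx mulr1 big1 ?addr0// => j ji.
  by rewrite mxE (negbTE ji) mulr0.
by rewrite -xz -expr2 mulrC; exact: posdef_CauchySchwarz.
Qed.

Lemma posdef_scalar1 m : posdef (1%:M : 'M[R]_m).
Proof.
by split=> [|x x0]; rewrite ?trmx1// -mulmxA mul1mx dotvE dotv_gt0.
Qed.

(** Cauchy-Schwarz on each row; the constant is the squared Frobenius norm. *)
Lemma mulmx_bounded m p (M : 'M[R]_(m, p)) :
  exists2 c, 0 <= c & forall x, dotv (M *m x) (M *m x) <= c * dotv x x.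
Proof.
exists (\sum_i dotv (row i M)^T (row i M)^T) => [|x].
  by apply: sumr_ge0 => i _; exact: dotv_ge0.
rewrite mulr_suml; apply: ler_sum => i _.
have := posdef_CauchySchwarz (row i M)^T x (@posdef_scalar1 p).
rewrite !mul1mx (_ : dotv _ x = (M *m x) i 0) ?expr2//.
by rewrite mxE; apply: eq_bigr => j _; rewrite !mxE.
Qed.

Lemma posdiag_tr m (D : 'M[R]_m) : posdiag D -> D^T = D.
Proof.
move=> [/is_diag_mxP D0 _]; apply/matrixP => i j; rewrite mxE.
by have [->//|ij] := eqVneq i j; rewrite !D0// eq_sym.
Qed.

Lemma posdiag_mulmx m (D : 'M[R]_m) (x : 'cV[R]_m) i :
  posdiag D -> (D *m x) i 0 = D i i * x i 0.
Proof.
move=> [/is_diag_mxP D0 _]; rewrite mxE (bigD1 i)//= big1 ?addr0// => j ji.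
by rewrite D0 ?mul0r// eq_sym.
Qed.

Lemma posdiag_posdef m (D : 'M[R]_m) : posdiag D -> posdef D.
Proof.
move=> D0; split=> [|x x0]; first exact: posdiag_tr.
rewrite -mulmxA dotvE; have := dotv_gt0 x0.
rewrite {1}/dotv lt_neqAle => /andP[xx _].
rewrite lt_neqAle eq_sym; apply/andP; split; last first.
  by apply: sumr_ge0 => i _; rewrite posdiag_mulmx// mulrCA -expr2 mulr_ge0 ?sqr_ge0// ltW// D0.2.
apply: contra xx; rewrite psumr_eq0 => [/allP H|i _]; last first.
  by rewrite posdiag_mulmx// mulrCA -expr2 mulr_ge0 ?sqr_ge0// ltW// D0.2.
rewrite eq_sym big1// => i _.
have := H i (mem_index_enum i); rewrite /= posdiag_mulmx// mulrCA mulf_eq0.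
by rewrite gt_eqF ?D0.2//= => /eqP.
Qed.

(** * Derivatives of vector-valued curves *)

Definition halfline_derivev m (u v : R -> 'cV[R]_m) : Prop :=
  forall i, halfline_derive (fun t => u t i 0) (fun t => v t i 0).

Lemma halfline_derivev_dotv m (u v du dv : R -> 'cV[R]_m) :
  halfline_derivev u du -> halfline_derivev v dv ->
  halfline_derive (fun t => dotv (u t) (v t))
    (fun t => dotv (du t) (v t) + dotv (u t) (dv t)).
Proof.
move=> udu vdv.
apply: halfline_derive_ext (halfline_derive_sum (fun i => halfline_deriveM (udu i) (vdv i))).
by move=> t _; rewrite big_split.
Qed.

Lemma halfline_derivev_mulmx m p (M : 'M[R]_(m, p)) (u du : R -> 'cV[R]_p) :
  halfline_derivev u du -> halfline_derivev (fun t => M *m u t) (fun t => M *m du t).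
Proof.
move=> udu i; under eq_fun do rewrite mxE.
under [X in halfline_derive _ X]eq_fun do rewrite mxE.
by apply: halfline_derive_sum => j; exact: halfline_deriveZ.
Qed.

Lemma halfline_derivevD m (u v du dv : R -> 'cV[R]_m) :
  halfline_derivev u du -> halfline_derivev v dv ->
  halfline_derivev (fun t => u t + v t) (fun t => du t + dv t).
Proof.
move=> udu vdv i; under eq_fun do rewrite mxE.
under [X in halfline_derive _ X]eq_fun do rewrite mxE.
exact: halfline_deriveD.
Qed.

End DotProduct.

(** * The coupled system *)

Section CoupledSystem.
Set Implicit Arguments.
Unset Strict Implicit.
Variables (R : realType) (n Nc : nat).
Variables (L : 'M[R]_n) (K : 'M[R]_Nc) (C : 'M[R]_(n, Nc)) (Gam : 'M[R]_Nc).

(** * Phase space, trajectories and existence of solutions *)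

(** A point of phase space [(a, a', eta, eta')]. Energy estimates become pointwise inequalities on
    states, with time entering only through [trajectory]. *)
Record state := State {pos : 'cV[R]_n; vel : 'cV[R]_n; aux : 'cV[R]_Nc; daux : 'cV[R]_Nc}.

Definition accel (x : state) : 'cV[R]_n := C *m aux x - L *m pos x.

Definition dacc (x : state) : 'cV[R]_Nc :=
  C^T *m pos x - K *m aux x - 2 *: (Gam *m daux x).

Definition trajectory (X : R -> state) : Prop :=
  [/\ halfline_derivev (pos \o X) (vel \o X), halfline_derivev (vel \o X) (accel \o X),
      halfline_derivev (aux \o X) (daux \o X) & halfline_derivev (daux \o X) (dacc \o X)].

Definition nrg (x : state) : R :=
  2^-1 * (dotv (vel x) (vel x) + dotv (daux x) (daux x)
    + dotv (pos x) (L *m pos x) + dotv (aux x) (K *m aux x)) - dotv (pos x) (C *m aux x).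

Lemma nrgE a da eta deta (t : R) :
  energy L K C a da eta deta t = nrg (State (a t) (da t) (eta t) (deta t)).
Proof.
rewrite /energy /stiffness /nrg /= !tr_col_mx mul_row_col -mulmxA mul_block_col mul_row_col.
rewrite !mxE; set s1 := \sum_j _; set s2 := \sum_j _; set s3 := \sum_j _; set s4 := \sum_j _.
have -> : s1 = dotv (da t) (da t) by apply: eq_bigr => i _; rewrite mxE.
have -> : s2 = dotv (deta t) (deta t) by apply: eq_bigr => i _; rewrite mxE.
have -> : s3 = dotv (a t) (L *m a t + - C *m eta t) by apply: eq_bigr => i _; rewrite mxE.
have -> : s4 = dotv (eta t) (- C^T *m a t + K *m eta t) by apply: eq_bigr => i _; rewrite mxE.
rewrite !mulNmx !dotv_lin (dotvC (eta t) (C^T *m _)) dotv_mulmxl trmxK.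
by field.
Qed.

Lemma solution_trajectory a da eta deta :
  is_solution L K C Gam a da eta deta ->
  trajectory (fun t => State (a t) (da t) (eta t) (deta t)).
Proof.
move=> [dda [ddeta [[a1 a2] [e1 e2] ea ee]]]; split=> i.
- exact: deriv_halfline_coord a1.
- apply: halfline_derive_ext (deriv_halfline_coord i a2) => t t0.
  by rewrite /= /accel /= -ea ?ltW// addrK.
- exact: deriv_halfline_coord e1.
- apply: halfline_derive_ext (deriv_halfline_coord i e2) => t t0.
  by rewrite /= /dacc /= -ee ?ltW// addrK addrK.
Qed.

(** [dV] plays the role of the Lie derivative of [V] along the vector field of the system. *)
Definition along (V dV : state -> R) : Prop :=
  forall X, trajectory X -> halfline_derive (V \o X) (dV \o X).

Lemma solution_exists (a0 b0 : 'cV[R]_n) (e0 z0 : 'cV[R]_Nc) :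
  exists a da eta deta, is_solution L K C Gam a da eta deta /\
    [/\ a 0 = a0, da 0 = b0, eta 0 = e0 & deta 0 = z0].
Proof.
(* First-order form of the system in the ordering [(a, eta, a', eta')]; the damping block acts on
   [eta'] only. *)
pose A : 'M[R]_((n + Nc) + (n + Nc)) := block_mx 0 1%:M (- stiffness L K C)
  (block_mx 0 0 0 (- 2 *: Gam)).
pose x := flow A (col_mx (col_mx a0 e0) (col_mx b0 z0)).
pose a t := usubmx (usubmx (x t)); pose e t := dsubmx (usubmx (x t)).
pose b t := usubmx (dsubmx (x t)); pose z t := dsubmx (dsubmx (x t)).
have xE t : x t = col_mx (col_mx (a t) (e t)) (col_mx (b t) (z t)) by rewrite !(vsubmxK, vsubmxK (x t)).
have AxE t : A *m x t = col_mx (col_mx (b t) (z t))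
    (col_mx (C *m e t - L *m a t) (C^T *m a t - K *m e t - 2 *: (Gam *m z t))).
  rewrite xE /A mul_block_col mul0mx add0r mul1mx mulNmx /stiffness !mul_block_col.
  rewrite !mul0mx !add0r opp_col_mx add_col_mx !mulNmx -scalemxAl addr0; congr col_mx.
  by congr col_mx; apply/colP => i; rewrite !mxE; ring.
have dx t i := flow_derive A (col_mx (col_mx a0 e0) (col_mx b0 z0)) t i.
have x0 : x 0 = col_mx (col_mx a0 e0) (col_mx b0 z0) by exact: flow0.
exists a, b, e, z; split; last first.
  by rewrite /a /b /e /z x0 !(col_mxKu, col_mxKd).
exists (fun t => C *m e t - L *m a t), (fun t => C^T *m a t - K *m e t - 2 *: (Gam *m z t)).
split=> [||t _|t _]; try split.
- apply: is_derive_deriv_halfline => t i.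
  have := dx t (lshift _ (lshift _ i)); rewrite -/x AxE !col_mxEu.
  by congr is_derive; apply/funext => s; rewrite !mxE.
- apply: is_derive_deriv_halfline => t i.
  have := dx t (rshift _ (lshift _ i)); rewrite -/x AxE col_mxEd col_mxEu.
  by congr is_derive; apply/funext => s; rewrite !mxE.
- apply: is_derive_deriv_halfline => t i.
  have := dx t (lshift _ (rshift _ i)); rewrite -/x AxE col_mxEu col_mxEd.
  by congr is_derive; apply/funext => s; rewrite !mxE.
- apply: is_derive_deriv_halfline => t i.
  have := dx t (rshift _ (rshift _ i)); rewrite -/x AxE !col_mxEd.
  by congr is_derive; apply/funext => s; rewrite !mxE.
- by rewrite subrK.
- by rewrite !subrK.
Qed.

(** * Energy balance and linear observables *)

Hypothesis L_sym : L^T = L.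
Hypothesis K_sym : K^T = K.

(** Every conservative contribution cancels, by symmetry of [L] and [K] and because the two
    couplings are [C] and its transpose. *)
Lemma nrg_along : along nrg (fun x => - 2 * dotv (daux x) (Gam *m daux x)).
Proof.
move=> X [a1 a2 e1 e2].
have h1 := halfline_derivev_dotv a2 a2.
have h2 := halfline_derivev_dotv e2 e2.
have h3 := halfline_derivev_dotv a1 (halfline_derivev_mulmx L a1).
have h4 := halfline_derivev_dotv e1 (halfline_derivev_mulmx K e1).
have h5 := halfline_derivev_dotv a1 (halfline_derivev_mulmx C e1).
have := halfline_deriveD
  (halfline_deriveZ 2^-1 (halfline_deriveD (halfline_deriveD (halfline_deriveD h1 h2) h3) h4))
  (halfline_deriveZ (-1) h5).
rewrite (_ : (fun t => _) = nrg \o X); last by apply/funext => t; rewrite /= mulN1r.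
apply: halfline_derive_ext => t _ /=; rewrite /accel /dacc.
case: (X t) => a b e z /=; rewrite !dotv_lin (dotvC (Gam *m z) z).
rewrite (dotvC (C *m e) b) (dotvC (L *m a) b) (dotvC (C^T *m a) z) (dotvC (K *m e) z).
have -> : dotv a (L *m b) = dotv b (L *m a) by rewrite (dotvC b) dotv_mulmxl L_sym.
have -> : dotv e (K *m z) = dotv z (K *m e) by rewrite (dotvC z) dotv_mulmxl K_sym.
have -> : dotv a (C *m z) = dotv z (C^T *m a) by rewrite (dotvC z) dotv_mulmxl trmxK.
by field.
Qed.

Lemma alongD V W dV dW : along V dV -> along W dW ->
  along (fun x => V x + W x) (fun x => dV x + dW x).
Proof. by move=> aV aW X tX; exact: halfline_deriveD (aV X tX) (aW X tX). Qed.

Lemma alongZ c V dV : along V dV -> along (fun x => c * V x) (fun x => c * dV x).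
Proof. by move=> aV X tX; exact: halfline_deriveZ (aV X tX). Qed.

Definition obs m (A1 A2 : 'M[R]_(m, n)) (A3 A4 : 'M[R]_(m, Nc)) (x : state) : 'cV[R]_m :=
  A1 *m pos x + A2 *m vel x + A3 *m aux x + A4 *m daux x.

Definition dobs m (A1 A2 : 'M[R]_(m, n)) (A3 A4 : 'M[R]_(m, Nc)) (x : state) : 'cV[R]_m :=
  A1 *m vel x + A2 *m accel x + A3 *m daux x + A4 *m dacc x.

(** Substituting the equations for the accelerations shows that linear observables are closed under
    differentiation, so second derivatives are again of this form. *)
Lemma dobsE m (A1 A2 : 'M[R]_(m, n)) (A3 A4 : 'M[R]_(m, Nc)) x :
  dobs A1 A2 A3 A4 x =
  obs (A4 *m C^T - A2 *m L) A1 (A2 *m C - A4 *m K) (A3 - 2 *: (A4 *m Gam)) x.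
Proof.
rewrite /dobs /obs /accel /dacc !mulmxBr !mulmxBl -!mulmxA -scalemxAr -scalemxAl -mulmxA.
by apply/colP => i; rewrite !mxE; ring.
Qed.

Lemma obs_along m (A1 A2 : 'M[R]_(m, n)) (A3 A4 : 'M[R]_(m, Nc)) X : trajectory X ->
  halfline_derivev (obs A1 A2 A3 A4 \o X) (dobs A1 A2 A3 A4 \o X).
Proof.
move=> [? ? ? ?]; do 3!(apply: halfline_derivevD; last exact: halfline_derivev_mulmx).
exact: halfline_derivev_mulmx.
Qed.

(** * Coercivity of the energy *)

Hypothesis L_pos : posdef L.
Hypothesis schur_pos : posdef (K - C^T *m invmx L *m C).

(** Completing the square in [pos] leaves four nonnegative terms; each of the energy bounds below
    keeps one of them and drops the rest. *)
Lemma nrg_square x :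
  let w := pos x - invmx L *m (C *m aux x) in
  nrg x = 2^-1 * (dotv (vel x) (vel x) + dotv (daux x) (daux x) + dotv w (L *m w)
    + dotv (aux x) ((K - C^T *m invmx L *m C) *m aux x)).
Proof.
case: x => a b e z; rewrite /nrg /= mulmxBr mulmxBl mulKVmx ?posdef_unit// !dotv_lin.
rewrite -!mulmxA -(dotv_mulmxl C e) (dotvC (invmx L *m _) (C *m e)).
have -> : dotv (invmx L *m (C *m e)) (L *m a) = dotv a (C *m e).
  by rewrite dotvC dotv_mulmxl L_sym mulKVmx ?posdef_unit.
by field.
Qed.

Lemma nrg_ge0 x : 0 <= nrg x.
Proof.
by rewrite nrg_square mulr_ge0// !addr_ge0// ?dotv_ge0 ?posdef_ge0.
Qed.

Lemma daux_le_nrg x : dotv (daux x) (daux x) <= 2 * nrg x.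
Proof.
rewrite nrg_square mulrA mulfV// mul1r addrAC -addrA -addrA (addrC (dotv (vel x) _)) -!addrA lerDl.
by rewrite !addr_ge0// ?dotv_ge0 ?posdef_ge0.
Qed.

(** The energy balance gives [E' >= - 2 g |eta'|^2], and [|eta'|^2 <= 2 E] accounts for the factor
    [4]. *)
Lemma nrg_lower_decay (g : R) : 0 <= g ->
  (forall z : 'cV[R]_Nc, dotv z (Gam *m z) <= g * dotv z z) ->
  forall X, trajectory X ->
  forall t, 0 <= t -> expR (- (4 * g) * t) * nrg (X 0) <= nrg (X t).
Proof.
move=> g0 Gg X tX t t0; apply: (gronwall_ge (nrg_along tX)) => // s s0 /=.
have := ler_wpM2l g0 (daux_le_nrg (X s)); have := Gg (daux (X s)); lra.
Qed.

Definition nrg_bounded m (F : state -> 'cV[R]_m) : Prop :=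
  exists2 c, 0 <= c & forall x, dotv (F x) (F x) <= c * nrg x.

Lemma nrg_bounded_mulmx m p (M : 'M[R]_(p, m)) F :
  nrg_bounded F -> nrg_bounded (fun x => M *m F x).
Proof.
move=> [c c0 Fc]; have [d d0 Md] := mulmx_bounded M.
exists (d * c) => [|x]; first exact: mulr_ge0.
by rewrite (le_trans (Md _))// -mulrA ler_wpM2l.
Qed.

Lemma dotvDD_le m (u v : 'cV[R]_m) : dotv (u + v) (u + v) <= 2 * dotv u u + 2 * dotv v v.
Proof. by have := dotv_ge0 (u - v); rewrite !dotv_lin (dotvC v u); lra. Qed.

Lemma nrg_boundedD m (F G : state -> 'cV[R]_m) :
  nrg_bounded F -> nrg_bounded G -> nrg_bounded (fun x => F x + G x).
Proof.
move=> [c c0 Fc] [d d0 Gd]; exists (2 * c + 2 * d) => [|x]; first lra.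
by rewrite (le_trans (dotvDD_le _ _))//; have := Fc x; have := Gd x; lra.
Qed.

Lemma nrg_bounded_vel : nrg_bounded vel.
Proof.
exists 2 => // x; rewrite nrg_square mulrA mulfV// mul1r -!addrA lerDl.
by rewrite !addr_ge0// ?dotv_ge0 ?posdef_ge0.
Qed.

Lemma nrg_bounded_daux : nrg_bounded daux.
Proof. by exists 2 => // x; exact: daux_le_nrg. Qed.

Lemma nrg_bounded_aux : nrg_bounded aux.
Proof.
have [c c0 H] := posdef_coercive schur_pos.
exists (c * 2) => [|x]; first by rewrite mulr_ge0.
rewrite (le_trans (H _))// -mulrA ler_wpM2l// nrg_square mulrA mulfV// mul1r lerDr.
by rewrite !addr_ge0// ?dotv_ge0 ?posdef_ge0.
Qed.

Lemma nrg_bounded_pos : nrg_bounded pos.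
Proof.
have [c c0 H] := posdef_coercive L_pos.
pose w x := pos x - invmx L *m (C *m aux x).
have wb : nrg_bounded w.
  exists (c * 2) => [|x]; first by rewrite mulr_ge0.
  rewrite (le_trans (H _))// -mulrA ler_wpM2l// nrg_square mulrA mulfV// mul1r -/(w x).
  by rewrite addrAC lerDr !addr_ge0// ?dotv_ge0 ?posdef_ge0.
have := nrg_boundedD wb (nrg_bounded_mulmx (invmx L *m C) nrg_bounded_aux).
rewrite (_ : (fun x => _) = pos)//.
by apply/funext => x; rewrite -mulmxA subrK.
Qed.

Lemma nrg_bounded_obs m (A1 A2 : 'M[R]_(m, n)) (A3 A4 : 'M[R]_(m, Nc)) :
  nrg_bounded (obs A1 A2 A3 A4).
Proof.
apply: nrg_boundedD; last exact/nrg_bounded_mulmx/nrg_bounded_daux.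
apply: nrg_boundedD; last exact/nrg_bounded_mulmx/nrg_bounded_aux.
apply: nrg_boundedD; last exact/nrg_bounded_mulmx/nrg_bounded_vel.
exact/nrg_bounded_mulmx/nrg_bounded_pos.
Qed.

(** * Quantities controlled by the dissipation *)

(* [V] and [M] may depend on [e]; being uniform over trajectories, they give uniform
   rates. *)
Definition controlled (q : state -> R) : Prop :=
  forall e, 0 < e -> exists V dV : state -> R, exists M c : R,
    [/\ along V dV, 0 <= M, 0 <= c, forall x, `|V x| <= c * nrg x &
        forall x, dV x <= - q x + M * dotv (daux x) (daux x) + e * nrg x].

Definition controlledv m (F : state -> 'cV[R]_m) : Prop :=
  controlled (fun x => dotv (F x) (F x)).

Lemma controlled_le q r : (forall x, q x <= r x) -> controlled r -> controlled q.
Proof.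
move=> qr Cr e /Cr[V [dV [M [c [aV M0 c0 Vc dVM]]]]].
exists V, dV, M, c; split=> // x.
by rewrite (le_trans (dVM x))// !lerD2r lerN2.
Qed.

Lemma controlledD q r : controlled q -> controlled r -> controlled (fun x => q x + r x).
Proof.
move=> Cq Cr e e0; have h0 : 0 < e / 2 by rewrite divr_gt0.
have [V [dV [M [c [aV M0 c0 Vc dVM]]]]] := Cq _ h0.
have [W [dW [M' [d [aW M0' d0 Wc dWM]]]]] := Cr _ h0.
exists (fun x => V x + W x), (fun x => dV x + dW x), (M + M'), (c + d).
split=> [||| x| x]; [exact: alongD | exact: addr_ge0 | exact: addr_ge0 | |].
  by rewrite (le_trans (ler_normD _ _))// mulrDl lerD.
by have := dVM x; have := dWM x; lra.
Qed.

Lemma controlledZ k q : 0 <= k -> controlled q -> controlled (fun x => k * q x).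
Proof.
move=> k0 Cq e e0; have k1 : 0 < k + 1 by lra.
have [V [dV [M [c [aV M0 c0 Vc dVM]]]]] := Cq _ (divr_gt0 e0 k1).
exists (fun x => k * V x), (fun x => k * dV x), (k * M), (k * c).
split=> [||| x| x]; [exact: alongZ | exact: mulr_ge0 | exact: mulr_ge0 | |].
  by rewrite normrM ger0_norm// -mulrA ler_wpM2l.
have ke : k * (e / (k + 1)) <= e.
  by rewrite mulrA ler_pdivrMr//; lra.
by have := ler_wpM2r (nrg_ge0 x) ke; have := ler_wpM2l k0 (dVM x); lra.
Qed.

Lemma controlledv_mulmx m p (M : 'M[R]_(p, m)) F :
  controlledv F -> controlledv (fun x => M *m F x).
Proof.
have [c c0 Mc] := mulmx_bounded M.
by move=> /(controlledZ c0); apply: controlled_le.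
Qed.

Lemma controlledvD m (F G : state -> 'cV[R]_m) :
  controlledv F -> controlledv G -> controlledv (fun x => F x + G x).
Proof.
move=> /(@controlledZ 2 _ (ler0n _ _)) FC /(@controlledZ 2 _ (ler0n _ _)) GC.
by apply: controlled_le (controlledD FC GC) => x; exact: dotvDD_le.
Qed.

Lemma controlledv_ext m (F G : state -> 'cV[R]_m) :
  (forall x, F x = G x) -> controlledv F -> controlledv G.
Proof. by move=> /funext ->. Qed.

(** Base case of the propagation: [V = 0] and [M = 1] suffice. *)
Lemma controlledv_daux : controlledv daux.
Proof.
move=> e e0; exists (fun=> 0), (fun=> 0), 1, 0; split=> // [X _|x|x].
- exact: halfline_derive_cst.
- by rewrite normr0 mul0r.
- by rewrite mul1r addNr add0r mulr_ge0 ?nrg_ge0// ltW.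
Qed.

Lemma controlledv_dobs m (A1 A2 : 'M[R]_(m, n)) (A3 A4 : 'M[R]_(m, Nc)) :
  controlledv (obs A1 A2 A3 A4) -> controlledv (dobs A1 A2 A3 A4).
Proof.
set F := obs A1 A2 A3 A4; set G := dobs A1 A2 A3 A4 => CF e e0.
pose B1 := A4 *m C^T - A2 *m L; pose B3 := A2 *m C - A4 *m K.
pose B4 := A3 - 2 *: (A4 *m Gam); pose H := dobs B1 A1 B3 B4.
have GE : G = obs B1 A1 B3 B4 by apply/funext => x; exact: dobsE.
have [f f0 Ff] : nrg_bounded F by exact: nrg_bounded_obs.
have [g g0 Gg] : nrg_bounded G by rewrite GE; exact: nrg_bounded_obs.
have [h h0 Hh] : nrg_bounded H.
  by rewrite /H (funext (dobsE _ _ _ _)); exact: nrg_bounded_obs.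
have FGH : along (fun x => -1 * dotv (F x) (G x))
    (fun x => -1 * (dotv (G x) (G x) + dotv (F x) (H x))).
  apply: alongZ => X tX; have FG := obs_along A1 A2 A3 A4 tX.
  have := obs_along B1 A1 B3 B4 tX; rewrite -GE => GH.
  exact: halfline_derivev_dotv FG GH.
(* Young's inequality with weight [r] bounds [- <F, H>] by [(r^-1 / 2) |F|^2 + (r / 2) |H|^2]. The
   last term is at most [e / 2] times the energy; the first is absorbed by a functional for
   [(r^-1 / 2) |F|^2] with tolerance [e / 2]. The [+ 1] covers [h = 0]. *)
pose r := e / (h + 1); have h1 : 0 < h + 1 by lra.
have r0 : 0 < r by rewrite divr_gt0.
have rh : r * h <= e by rewrite /r mulrAC ler_pdivrMr//; lra.
have rI : 0 <= r^-1 / 2 by rewrite divr_ge0// invr_ge0 ltW.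
have [V [dV [M [c [aV M0 c0 Vc dVM]]]]] := controlledZ rI CF (divr_gt0 e0 (ltr0Sn _ 1)).
exists (fun x => -1 * dotv (F x) (G x) + V x),
  (fun x => -1 * (dotv (G x) (G x) + dotv (F x) (H x)) + dV x), M, ((f + g) / 2 + c).
split=> // [||x|x].
- exact: alongD.
- by rewrite addr_ge0// divr_ge0// addr_ge0.
- rewrite (le_trans (ler_normD _ _))// mulrDl lerD// mulN1r normrN ler_norml.
  have := dotv_young (F x) (G x) ltr01; have := dotv_youngN (F x) (G x) ltr01.
  rewrite invr1; have := Ff x; have := Gg x.
  by move=> ? ? ? ?; apply/andP; split; lra.
have := dotv_youngN (F x) (H x) r0.
have := ler_wpM2l (ltW r0) (Hh x); have := ler_wpM2r (nrg_ge0 x) rh; have := dVM x.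
lra.
Qed.

Lemma controlledv_comb m k p (F : state -> 'cV[R]_m) (G : state -> 'cV[R]_k)
    (H : state -> 'cV[R]_p) (A : 'M[R]_(p, m)) (B : 'M[R]_(p, k)) :
  (forall x, H x = A *m F x + B *m G x) ->
  controlledv F -> controlledv G -> controlledv H.
Proof.
by move=> /funext -> CF CG; apply: controlledvD; exact: controlledv_mulmx.
Qed.

Lemma controlled_sum m (q : 'I_m -> state -> R) :
  (forall i, controlled (q i)) -> controlled (fun x => \sum_i q i x).
Proof.
elim: m q => [|m IH] q Cq.
  apply: controlled_le (controlledZ (lexx 0) controlledv_daux) => x.
  by rewrite big_ord0 mul0r.
under eq_fun do rewrite big_ord_recl.
by apply: controlledD => //; exact: IH.
Qed.

(** * Propagation of control from the damped variable to the whole energy *)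

Lemma controlledv_dacc : controlledv dacc.
Proof.
apply: controlledv_ext (controlledv_dobs (A1 := 0) (A2 := 0) (A3 := 0) (A4 := 1%:M) _).
  by move=> x; rewrite /dobs !mul0mx !add0r mul1mx.
apply: controlledv_ext controlledv_daux => x.
by rewrite /obs !mul0mx !add0r mul1mx.
Qed.

Lemma controlledv_force : controlledv (fun x => C^T *m pos x - K *m aux x).
Proof.
apply: (controlledv_comb (A := 1%:M) (B := 2 *: Gam)) controlledv_dacc controlledv_daux => x.
by rewrite mul1mx /dacc -scalemxAl subrK.
Qed.

(** The derivative of the force [C^T a - K eta] is [C^T a' - K eta'], and [eta'] is already
    controlled. *)
Lemma controlledv_CTvel : controlledv (fun x => C^T *m vel x).
Proof.
have : controlledv (dobs C^T 0 (- K) 0).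
  apply: controlledv_dobs; apply: controlledv_ext controlledv_force => x.
  by rewrite /obs !mul0mx mulNmx !addr0.
move=> /(controlledv_comb (A := 1%:M) (B := K)); apply; last exact: controlledv_daux.
by move=> x; rewrite mul1mx /dobs !mul0mx !addr0 mulNmx subrK.
Qed.

(** Differentiating [C^T Q a'] twice gives [C^T Q (C eta' - L a')]; the term in [eta'] is
    controlled, which isolates one more factor [L]. *)
Lemma controlledv_CTvel_mulL (Q : 'M[R]_n) :
  controlledv (fun x => C^T *m Q *m vel x) ->
  controlledv (fun x => C^T *m (Q *m L) *m vel x).
Proof.
move=> CQ.
have C1 : controlledv (dobs 0 (C^T *m Q) 0 0).
  apply: controlledv_dobs; apply: controlledv_ext CQ => x.
  by rewrite /obs !mul0mx add0r !addr0.
have C2 : controlledv (dobs (- (C^T *m Q *m L)) 0 (C^T *m Q *m C) 0).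
  apply: controlledv_dobs; apply: controlledv_ext C1 => x.
  rewrite /obs /dobs /accel !mul0mx add0r !addr0 mulmxBr mulNmx -!mulmxA.
  by rewrite addrC.
apply: (controlledv_comb (A := - 1%:M) (B := C^T *m Q *m C)) C2 controlledv_daux => x.
rewrite /dobs !mul0mx !addr0 mulNmx mul1mx mulNmx opprD opprK -!mulmxA.
by rewrite subrK.
Qed.

(** For diagonal [L] this diagonal matrix is the polynomial [prod (L - mu)] over [s]. Each new
    factor costs one multiplication by [L] and a multiple of the previous observable. *)
Lemma controlledv_CTvel_prod (s : seq R) : is_diag_mx L ->
  controlledv (fun x => C^T *m diag_mx (\row_i \prod_(mu <- s) (L i i - mu)) *m vel x).
Proof.
move=> Ld; elim: s => [|mu s IH].
  apply: controlledv_ext controlledv_CTvel => x.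
  congr (_ *m _); rewrite -[LHS]mulmx1; congr (_ *m _).
  by apply/matrixP => i j; rewrite !mxE big_nil.
set D := diag_mx _ in IH.
apply: (controlledv_comb (A := 1%:M) (B := - mu%:M)) (controlledv_CTvel_mulL IH) IH => x.
rewrite mul1mx mulNmx mul_scalar_mx scalemxAl scalemxAr -mulmxBl -mulmxBr.
congr (_ *m _ *m _); rewrite /D mul_diag_mx; apply/matrixP => i j; rewrite !mxE big_cons.
have [<-|ij] := eqVneq i j; first by rewrite !mulr1n; ring.
by rewrite !mulr0n (elimT is_diag_mxP Ld i j ij) !mulr0 subr0.
Qed.

(* The product over the eigenvalues other than [L j j] is a nonzero multiple [D] of the
   spectral projection; observability makes [C^T] injective on the range of [D], so that
   [D] factors through [C^T D]. *)
Lemma controlled_vel_coord (j : 'I_n) : is_diag_mx L ->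
  (forall x : 'cV[R]_n, L *m x = L j j *: x -> C^T *m x = 0 -> x = 0) ->
  controlled (fun x => vel x j 0 * vel x j 0).
Proof.
move=> Ld obsj.
pose s := [seq L k k | k <- enum 'I_n & L k k != L j j].
pose d : 'rV[R]_n := \row_i \prod_(mu <- s) (L i i - mu).
have d0 i : L i i != L j j -> d 0 i = 0.
  move=> ij; apply/eqP; rewrite mxE prodf_seq_eq0; apply/hasP; exists (L i i);
    last by rewrite /= subrr.
  by apply/mapP; exists i; rewrite // mem_filter ij mem_enum.
have dj : d 0 j != 0.
  rewrite mxE prodf_seq_neq0; apply/allP => mu /mapP[k].
  by rewrite mem_filter => /andP[kj _] ->; rewrite /= subr_eq0 eq_sym.
have LD (u : 'cV[R]_n) : L *m (diag_mx d *m u) = L j j *: (diag_mx d *m u).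
  apply/colP => i; rewrite mul_diag_mx mxE (bigD1 i)//= big1 => [|k ki].
    rewrite !mxE addr0; have [->//|/d0] := eqVneq (L i i) (L j j).
    by rewrite mxE => ->; rewrite !mul0r !mulr0.
  by rewrite (elimT is_diag_mxP Ld i k) ?mul0r// eq_sym.
(* The row-space inclusion is tested on the cokernel: each column of the product is an eigenvector
   for [L j j] or zero by [LD], and is killed by [C^T], so it vanishes. *)
have /submxP[M DM] : (diag_mx d <= C^T *m diag_mx d)%MS.
  rewrite submxE; apply/eqP/matrixP => i k.
  have : col k (diag_mx d *m cokermx (C^T *m diag_mx d)) = 0.
    rewrite colE -mulmxA; apply: obsj; first exact: LD.
    by rewrite mulmxA (mulmxA (C^T *m diag_mx d)) mulmx_coker mul0mx.
  by move=> /colP/(_ i); rewrite !mxE.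
have := controlledv_mulmx M (controlledv_CTvel_prod s Ld).
under eq_fun do rewrite -/d mulmxA -DM.
have dj2 : 0 <= (d 0 j ^+ 2)^-1 by rewrite invr_ge0 sqr_ge0.
move=> /(controlledZ dj2); apply: controlled_le => x.
rewrite ler_pdivlMl; last by rewrite lt_neqAle sqr_ge0 eq_sym sqrf_eq0 dj.
rewrite /dotv (bigD1 j)//= mul_diag_mx !mxE -[leLHS]addr0 lerD//.
  by rewrite le_eqVlt; apply/orP; left; apply/eqP; ring.
by apply: sumr_ge0 => i _; rewrite -expr2 sqr_ge0.
Qed.

Hypothesis L_diag : is_diag_mx L.
Hypothesis L_obs : forall j (x : 'cV[R]_n),
  L *m x = L j j *: x -> C^T *m x = 0 -> x = 0.

Lemma controlledv_vel : controlledv vel.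
Proof. by apply: controlled_sum => j; apply: controlled_vel_coord => // x; exact: L_obs. Qed.

Lemma controlledv_accel : controlledv accel.
Proof.
apply: controlledv_ext (controlledv_dobs (A1 := 0) (A2 := 1%:M) (A3 := 0) (A4 := 0) _).
  by move=> x; rewrite /dobs !mul0mx !addr0 add0r mul1mx.
apply: controlledv_ext controlledv_vel => x.
by rewrite /obs !mul0mx !addr0 add0r mul1mx.
Qed.

(** Eliminating [a] between the two forces: [S eta = - (C^T a - K eta) - C^T L^-1 (C eta - L a)],
    with [S] the invertible Schur complement. *)
Lemma controlledv_aux : controlledv aux.
Proof.
pose S := K - C^T *m invmx L *m C.
have Su : S \in unitmx by exact: posdef_unit.
apply: (controlledv_comb (A := - invmx S) (B := - (invmx S *m (C^T *m invmx L))))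
  controlledv_force controlledv_accel => x.
rewrite !mulNmx -mulmxA -opprD -mulmxDr -mulmxN.
rewrite (_ : - _ = S *m aux x) ?mulKmx//.
rewrite /accel mulmxBr -(mulmxA _ _ (L *m _)) mulKmx ?posdef_unit// /S mulmxBl !mulmxA.
by apply/colP => i; rewrite !mxE; ring.
Qed.

Lemma controlledv_pos : controlledv pos.
Proof.
apply: (controlledv_comb (A := - invmx L) (B := invmx L *m C)) controlledv_accel controlledv_aux => x.
by rewrite /accel mulNmx mulmxBr mulKmx ?posdef_unit// -mulmxA opprB subrK.
Qed.

(** Young's inequality bounds the energy by a sum of squared norms of controlled observables. *)
Lemma controlled_nrg : controlled nrg.
Proof.
have Cp := controlledv_pos; have Cm := controlledv_aux.
apply: (controlled_le _ (controlledD (controlledD (controlledD controlledv_vel controlledv_daux)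
  (controlledD Cp (controlledv_mulmx L Cp)))
  (controlledD (controlledD Cm (controlledv_mulmx K Cm))
    (controlledD Cp (controlledv_mulmx C Cm))))) => x.
have := dotv_young (pos x) (L *m pos x) ltr01.
have := dotv_young (aux x) (K *m aux x) ltr01.
have := dotv_youngN (pos x) (C *m aux x) ltr01.
have := dotv_ge0 (vel x); have := dotv_ge0 (daux x); have := dotv_ge0 (pos x).
have := dotv_ge0 (aux x); have := dotv_ge0 (L *m pos x); have := dotv_ge0 (K *m aux x).
have := dotv_ge0 (C *m aux x).
rewrite /nrg invr1; lra.
Qed.

(** * The strict Lyapunov functional and exponential decay *)

Lemma nrg_decay : posdef Gam -> exists2 d, 0 < d & forall X, trajectory X ->
  forall t, 0 <= t -> nrg (X t) <= 3 * expR (- d * t) * nrg (X 0).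
Proof.
move=> Gam_pos; have [g g0 Gg] := posdef_coercive Gam_pos.
have [V [dV [M [c [aV M0 c0 Vc dVM]]]]] := controlled_nrg (divr_gt0 (ltr01 : 0 < 1 :> R) (ltr0Sn _ 1)).
(* With [th = D^-1], the first term gives [th * c <= 1 / 2], so [W] lies between [1 / 2] and [3 / 2]
   of the energy; the second gives [th * M * g <= 1], so the dissipation absorbs the [|eta'|^2]
   term; the last keeps [D] positive. *)
pose D := 2 * c + M * g + 1.
have Mg : 0 <= M * g by exact: mulr_ge0.
have D0 : 0 < D by rewrite /D; lra.
pose th := D^-1; have th0 : 0 < th by rewrite invr_gt0.
have thD : th * D = 1 by rewrite mulVf// gt_eqF.
have thc : th * c <= 1 / 2.
  have : 0 <= th * (M * g) by rewrite mulr_ge0// ltW.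
  by move: thD; rewrite /D; lra.
have thM : th * (M * g) <= 1.
  have : 0 <= th * c by rewrite mulr_ge0// ltW.
  by move: thD; rewrite /D; lra.
pose W x := nrg x + th * V x.
have aW : along W _ := alongD nrg_along (alongZ th aV).
have thV x : `|th * V x| <= 1 / 2 * nrg x.
  rewrite normrM gtr0_norm//; have := ler_wpM2l (ltW th0) (Vc x).
  by have := ler_wpM2r (nrg_ge0 x) thc; lra.
have Wlo x : nrg x <= 2 * W x by have := thV x; rewrite ler_norml /W => /andP[? ?]; lra.
have Whi x : W x <= 3 / 2 * nrg x by have := thV x; rewrite ler_norml /W => /andP[? ?]; lra.
(* Control with tolerance [1 / 2] yields [W' <= - (th / 2) E], and [W <= 3 / 2 E] turns this into
   [W' <= - (th / 3) W]. The prefactor [3] is [2] times [3 / 2]. *)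
exists (th / 3); first by rewrite divr_gt0.
move=> X tX t t0.
have := gronwall_le (k := th / 3) (aW X tX) _ t0.
move=> /(_ _)/wrap[s s0|].
  rewrite /=; have := ler_wpM2l (ltW th0) (dVM (X s)).
  have := ler_wpM2l (ltW th0) (Whi (X s)).
  have := ler_wpM2l (ltW th0) (ler_wpM2l M0 (Gg (daux (X s)))).
  have := ler_wpM2r (posdef_ge0 (daux (X s)) Gam_pos) thM.
  have := posdef_ge0 (daux (X s)) Gam_pos.
  lra.
rewrite /= => Wt.
have := ler_wpM2l (expR_ge0 (- (th / 3) * t)) (Whi (X 0)).
have := Wlo (X t); lra.
Qed.

End CoupledSystem.

Theorem theorem5p3 (R : realType) (n Nc : nat)
    (L : 'M[R]_n) (K : 'M[R]_Nc) (C : 'M[R]_(n, Nc))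
    (n_ge1 : (1 <= n)%N) (Nc_ge1 : (1 <= Nc)%N)
    (L_diag : posdiag L) (K_diag : posdiag K)
    (schur_pos : posdef (K - C^T *m invmx L *m C))
    (observable : forall lambda : R, eigenvalue L (lambda ^+ 2) ->
       forall x : 'cV[R]_n,
         (L - (lambda ^+ 2)%:M) *m x = 0 -> C^T *m x = 0 -> x = 0) :
  (forall Gam : 'M[R]_Nc, posdiag Gam -> posdef Gam ->
     exists M delta : R,
       [/\ 1 <= M, 0 < delta & energy_decay L K C Gam M delta]) /\
  (forall Gam0 : 'M[R]_Nc, posdiag Gam0 -> posdef Gam0 ->
     exists2 c : R, 0 < c &
       \forall gamma \near (0 : R)^'+,
         forall M delta : R,
           1 <= M -> 0 < delta ->
           energy_decay L K C (gamma *: Gam0) M delta ->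
           delta <= c * gamma).

Proof.
have L_pos := posdiag_posdef L_diag.
have [L_sym K_sym] := (posdiag_tr L_diag, posdiag_tr K_diag).
split=> [Gam _ Gam_pos | Gam0 _ _].
  have L_obs j (x : 'cV[R]_n) : L *m x = L j j *: x -> C^T *m x = 0 -> x = 0.
    (* Eigenvalues are written as squares in [observable], so [lambda] is the square root of the
       positive entry. [eigenvalue] concerns row vectors, hence the unit row below. *)
    have lj : Num.sqrt (L j j) ^+ 2 = L j j by rewrite sqr_sqrtr// ltW// L_diag.2.
    move=> Lx; apply: (observable (Num.sqrt (L j j))).
      apply/eigenvalueP; exists (delta_mx 0 j); last first.
        by apply/eqP => /rowP/(_ j)/eqP; rewrite !mxE !eqxx oner_eq0.
      rewrite lj -rowE; apply/rowP => k; rewrite !mxE eqxx /=.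
      have [->|kj] := eqVneq k j; first by rewrite mulr1.
      by rewrite (elimT is_diag_mxP L_diag.1) ?mulr0// eq_sym.
    by rewrite lj mulmxBl Lx mul_scalar_mx subrr.
  have [d d0 decay] := nrg_decay L_sym K_sym L_pos schur_pos L_diag.1 L_obs Gam_pos.
  exists 3, d; split=> // [|a da eta deta sol t t0]; first by rewrite ler1n.
  by rewrite !nrgE; exact: decay (solution_trajectory sol) _ t0.
have [c c0 Gc] := mulmx_bounded Gam0.
(* Young's inequality gives [<z, Gam0 z> <= (1 + c) / 2 * |z|^2]; with [g = (1 + c) / 2 * gamma],
   the lower decay rate [4 g] is [2 (1 + c) gamma]. *)
exists (2 * (1 + c)); first by lra.
near=> gamma => M delta M1 delta0 decay.
have gamma0 : 0 < gamma by near: gamma; exact: nbhs_right_gt.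
(* A test solution with only [a'] nonzero at time [0]: its initial energy is purely kinetic, and
   positive because [n >= 1]. *)
have [a [da [eta [deta [sol [a0 da0 eta0 deta0]]]]]] :=
  solution_exists L K C (gamma *: Gam0) 0 (const_mx 1) 0 0.
have E0 : 0 < energy L K C a da eta deta 0.
  rewrite nrgE /nrg /= a0 da0 eta0 deta0 !dotv0l !addr0 subr0 mulr_gt0// dotv_gt0//.
  by apply/eqP => /colP/(_ (Ordinal n_ge1))/eqP; rewrite !mxE oner_eq0.
rewrite leNgt; apply/negP => lt_delta.
(* The upper and lower bounds together force [expR (k * t) <= M] for all [t >= 0]. At [t = M / k]
   this reads [expR M <= M], against [expR M >= 1 + M]. *)
pose k := delta - 2 * (1 + c) * gamma; have k0 : 0 < k by rewrite subr_gt0.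
have t0 : 0 <= M / k by rewrite divr_ge0 ?(ltW k0)// (le_trans ler01).
have GG z : dotv z (gamma *: Gam0 *m z) <= (1 + c) / 2 * gamma * dotv z z.
  rewrite -scalemxAl dotvZr; have := dotv_young z (Gam0 *m z) ltr01; rewrite invr1.
  move=> Y; have dz : dotv z (Gam0 *m z) <= (1 + c) / 2 * dotv z z by have := Gc z; lra.
  by have := ler_wpM2l (ltW gamma0) dz; lra.
have g0 : 0 <= (1 + c) / 2 * gamma by rewrite mulr_ge0 ?divr_ge0 ?addr_ge0// ltW.
have lower := nrg_lower_decay L_sym K_sym L_pos schur_pos g0 GG (solution_trajectory sol) t0.
have upper := decay _ _ _ _ sol _ t0.
rewrite /= -!nrgE in lower.
have := le_trans lower upper; rewrite ler_pM2r// => {lower upper} H.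
have : expR (k * (M / k)) <= M.
  rewrite -(ler_pM2r (expR_gt0 (- delta * (M / k)))) -expRD.
  apply: le_trans H; rewrite ler_expR le_eqVlt; apply/orP; left; apply/eqP.
  by rewrite -mulrDl /k; congr (_ * _); field.
rewrite mulrCA divff ?gt_eqF// mulr1 => H2.
by have := expR_ge1Dx M; lra.
Unshelve. all: by end_near.
Qed.
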